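(* Let $\mathcal{G}$ be a connected, homogeneous, bidirected coupled cell network with cell set $\mathcal{C}=\{1,\dots,n\}$ and edge set $\mathcal{E}$, each cell having phase space $\mathbb{R}$. Let $f:\mathbb{R}^n\to\mathbb{R}^n$ be the $\mathcal{G}$-admissible vector field with components \[ f_c(x)=\sum_{d\in I(c)}\phi_{[(c,d)]}(x_d-x_c),\qquad c\in\mathcal{C}, \] where for each edge type $\xi$, $\phi_\xi:\mathbb{R}\to\mathbb{R}$ is an odd $C^1$ function. Suppose there exists $\varepsilon>0$ such that $\alpha\,\phi_\xi(\alpha)>0$ for all $\alpha\in(-\varepsilon,\varepsilon)\setminus\{0\}$ and all edge types $\xi$. Let $\Delta=\{x\in\mathbb{R}^n: x_1=\dots=x_n\}$ be the total synchrony subspace and let $\Omega=\{x\in\mathbb{R}^n:\operatorname{dist}(x,\Delta)<r\}$ be the largest open hypercylinder around $\Delta$ such that $x\in\Omega$ implies $|x_d-x_c|<\varepsilon$ for all $(c,d)\in\mathcal{E}$. Then, for the system $\dot x=f(x)$, the total synchrony subspace $\Delta$ (which consists of equilibria) is asymptotically stable on $\Omega$ in the sense of Lyapunov.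
   Context: A coupled cell network consists of cells $\mathcal{C}=\{1,\dots,n\}$, edges $\mathcal{E}\subset\mathcal{C}\times\mathcal{C}$ without loops, and an equivalence relation on edges (edge types; $[e]$ is the type of $e$) compatible with an equivalence relation on cells. The input set of $c$ is the set of edges $(d,c)\in\mathcal{E}$; one writes $d\in I(c)$ when $(d,c)\in\mathcal{E}$. Cells $c,d$ are input equivalent if there is an edge-type preserving bijection between their input sets; the network is homogeneous if all cells are input equivalent. It is bidirected if $(i,j)\in\mathcal{E}$ iff $(j,i)\in\mathcal{E}$, with $(i,j)$ and $(j,i)$ of the same type. Connected means the underlying graph is connected. Admissible maps have components depending only on the cell's own variable and its inputs, with identical functional form across input-equivalent cells, edges of the same type being treated identically. *)

(* Defs.v *)
From HB Require Import structures.
From mathcomp Require Import all_boot all_order all_algebra.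
From mathcomp Require Import all_classical all_reals all_analysis.
Set Implicit Arguments. Unset Strict Implicit. Unset Printing Implicit Defensive.
Import Order.TTheory GRing.Theory Num.Theory.
Import numFieldNormedType.Exports.
Local Open Scope classical_set_scope.
Local Open Scope ring_scope.

(* E d c  <=> (d, c) is an edge, i.e. d is an input of cell c  (d \in I(c)).
   etyp d c : T  is the type [(d,c)] of the edge (d,c) (meaningful only on edges);
   ctyp c : U   is the type (class) of cell c. *)

Definition no_loops n (E : rel 'I_n) : Prop := forall c, ~~ E c c.

Definition types_compatible n (T U : Type) (E : rel 'I_n)
  (etyp : 'I_n -> 'I_n -> T) (ctyp : 'I_n -> U) : Prop :=
  forall d c d' c', E d c -> E d' c' -> etyp d c = etyp d' c' ->
    ctyp d = ctyp d' /\ ctyp c = ctyp c'.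

Definition input_equiv n (T : Type) (E : rel 'I_n) (etyp : 'I_n -> 'I_n -> T)
  (c c' : 'I_n) : Prop :=
  exists g : 'I_n -> 'I_n,
    [/\ (forall d1 d2, E d1 c -> E d2 c -> g d1 = g d2 -> d1 = d2),
        (forall d, E d c -> E (g d) c' /\ etyp d c = etyp (g d) c') &
        (forall d', E d' c' -> exists2 d, E d c & g d = d')].

Definition homogeneous n (T : Type) (E : rel 'I_n) (etyp : 'I_n -> 'I_n -> T) :=
  forall c c', input_equiv E etyp c c'.

Definition bidirected n (T : Type) (E : rel 'I_n) (etyp : 'I_n -> 'I_n -> T) :=
  forall i j, (E i j = E j i) /\ (E i j -> etyp i j = etyp j i).

Definition connected_net n (E : rel 'I_n) :=
  forall c d, connect (fun a b => E a b || E b a) c d.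

Definition netfield (R : realType) n (T : Type) (E : rel 'I_n)
  (etyp : 'I_n -> 'I_n -> T) (phi : T -> R -> R) (x : 'I_n -> R) : 'I_n -> R :=
  fun c => \sum_(d | E d c) phi (etyp c d) (x d - x c).

Definition edist (R : realType) n (x y : 'I_n -> R) : R :=
  Num.sqrt (\sum_i (x i - y i) ^+ 2).

Definition Delta (R : realType) n : set ('I_n -> R) :=
  [set x | forall i j, x i = x j].

Definition dist_Delta (R : realType) n (x : 'I_n -> R) : R :=
  inf [set edist x y | y in @Delta R n].

Definition admissible_radius (R : realType) n (E : rel 'I_n) (eps r : R) : Prop :=
  forall x : 'I_n -> R, dist_Delta x < r ->
    forall d c, E d c -> `|x d - x c| < eps.

(* Omega: the largest admissible open hypercylinder around Delta
   (the union of all admissible ones). *)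
Definition Omega (R : realType) n (E : rel 'I_n) (eps : R) : set ('I_n -> R) :=
  [set x | exists r : R, admissible_radius E eps r /\ dist_Delta x < r].

Definition is_solution (R : realType) n (F : ('I_n -> R) -> 'I_n -> R)
  (x : R -> 'I_n -> R) : Prop :=
  (forall c, {within [set t : R | 0 <= t], continuous (fun t => x t c)}) /\
  (forall t : R, 0 < t -> forall c, is_derive t 1 (fun s => x s c) (F (x t) c)).

Definition asymp_stable_Delta_on (R : realType) n (F : ('I_n -> R) -> 'I_n -> R)
  (A : set ('I_n -> R)) : Prop :=
  (forall e : R, 0 < e -> exists2 delta : R, 0 < delta &
     forall x, is_solution F x -> dist_Delta (x 0) < delta ->
       forall t, 0 <= t -> dist_Delta (x t) < e) /\
  (forall x, is_solution F x -> A (x 0) ->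
     (fun t => dist_Delta (x t)) @ +oo --> (0 : R)).

(* Main.v *)
Require Import Defs.
From HB Require Import structures.
From mathcomp Require Import all_boot all_order all_algebra.
From mathcomp Require Import all_classical all_reals all_analysis.
From mathcomp Require Import ring lra.
Import Order.TTheory GRing.Theory Num.Theory.
Import numFieldNormedType.Exports.
Local Open Scope classical_set_scope.
Local Open Scope ring_scope.
Set Implicit Arguments. Unset Strict Implicit. Unset Printing Implicit Defensive.

(* The Lyapunov function is V(x) = sum_i (x_i - mean x)^2 = dist(x, Delta)^2.
   Bidirectedness and oddness of the coupling functions make the field sum to
   zero and give dV/dt = - sum over edges of (x_d - x_c) phi(x_d - x_c), which
   is nonpositive as long as every edge difference stays below eps, i.e. inside
   an admissible cylinder; V is therefore nonincreasing along solutions starting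
   there, which gives stability.  For attraction, connectedness forces some edge
   difference of size at least beta > 0 while V >= e^2, and shrinking the
   cylinder keeps all edge differences at most some rho < eps; continuity of
   phi on the compact ranges beta <= |a| <= rho then bounds -dV/dt below by a
   positive constant, so V drops below e^2 in finite time. *)

Section DerivativeBounds.
Context {R : realType}.

Lemma mean_value_le (f df : R -> R) (a b M : R) : a <= b ->
  (forall s, a < s < b -> is_derive s 1 f (df s)) ->
  (forall s, a < s < b -> df s <= M) ->
  {within `[a, b], continuous f} -> f b <= f a + M * (b - a).
Proof.
rewrite le_eqVlt => /orP[/eqP <-|a_lt_b] f_der df_le f_cont.
  by rewrite subrr mulr0 addr0.
have f_der' s : s \in `]a, b[ -> is_derive s 1 f (df s) by rewrite in_itv; exact: f_der.
have [s] := MVT a_lt_b f_der' f_cont; rewrite in_itv /= => s_ab f_ba.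
rewrite -lerBlDl f_ba; apply: ler_wpM2r; last exact: df_le.
by rewrite subr_ge0 ltW.
Qed.

Lemma subset_itv_nonneg (a b : R) : 0 <= a -> [set` `[a, b]] `<=` [set t : R | 0 <= t].
Proof. by move=> a_ge0 s /=; rewrite in_itv /= => /andP[/(le_trans a_ge0)]. Qed.

Variables (g dg : R -> R) (c : R).
Hypothesis g_cont : {within [set t : R | 0 <= t], continuous g}.
Hypothesis g_der : forall t : R, 0 < t -> is_derive t 1 g (dg t).
Hypothesis dg_le0 : forall t : R, 0 < t -> g t < c -> dg t <= 0.
Hypothesis g0_lt : g 0 < c.

(* At the first time [s] where [g] reaches [c], [g] has been nonincreasing on
   [0, s], so [g s <= g 0 < c], and by continuity [g < c] a little beyond [s]. *)
Lemma below_barrier (t : R) : 0 <= t -> g t < c.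
Proof.
move=> t_ge0; rewrite ltNge; apply/negP => c_le_gt.
pose B := [set s | 0 <= s /\ c <= g s].
have B_lb : has_lbound B by exists 0 => s [].
have B_ne : B !=set0 by exists t.
set s := inf B.
have s_ge0 : 0 <= s by apply: lb_le_inf => // u [].
have before_s u : 0 <= u -> u < s -> g u < c.
  move=> u_ge0 u_lt_s; rewrite ltNge; apply/negP => c_le_gu.
  by have := ge_inf B_lb (conj u_ge0 c_le_gu); rewrite leNgt u_lt_s.
have gs_lt : g s < c.
  have : g s <= g 0 + 0 * (s - 0).
    apply: (mean_value_le s_ge0).
    - by move=> u /andP[u_gt0 _]; exact: g_der.
    - by move=> u /andP[u_gt0 u_lt_s]; apply: dg_le0 (before_s _ (ltW u_gt0) u_lt_s).
    - exact: continuous_subspaceW (subset_itv_nonneg (lexx 0)) g_cont.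
  by rewrite mul0r addr0 => /le_lt_trans; apply.
have [d d_gt0 g_near_s] : exists2 d : R, 0 < d &
    forall u, 0 <= u -> `|s - u| < d -> `|g s - g u| < c - g s.
  have /subspace_continuousP/(_ s s_ge0)/cvgrPdist_lt := g_cont.
  move=> /(_ (c - g s)); rewrite subr_gt0 => /(_ gs_lt).
  rewrite near_withinE => /nbhs_ballP[d /= d_gt0 near_s].
  by exists d => // u u_ge0 su; exact: near_s.
have [u [u_ge0 c_le_gu] u_lt] := inf_adherent d_gt0 (conj B_ne B_lb).
have s_le_u : s <= u by exact: ge_inf.
have su_lt : `|s - u| < d by rewrite distrC ger0_norm ?subr_ge0 //; lra.
have := g_near_s u u_ge0 su_lt; rewrite distrC => /(le_lt_trans (ler_norm _)).
lra.
Qed.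

Lemma nonincreasing_below_barrier (s t : R) : 0 <= s -> s <= t -> g t <= g s.
Proof.
move=> s_ge0 s_le_t; rewrite -[X in _ <= X]addr0 -(mul0r (t - s)).
apply: (mean_value_le s_le_t).
- by move=> u /andP[s_lt_u _]; apply: g_der (le_lt_trans s_ge0 s_lt_u).
- move=> u /andP[s_lt_u _]; have u_gt0 := le_lt_trans s_ge0 s_lt_u.
  by apply: dg_le0 (below_barrier (ltW u_gt0)).
- exact: continuous_subspaceW (subset_itv_nonneg s_ge0) g_cont.
Qed.

End DerivativeBounds.

Section PositiveLowerBounds.
Context {R : realType}.

Lemma odd_pos_lower_bound (g : R -> R) (eps beta rho : R) :
  continuous g -> (forall a, g (- a) = - g a) ->
  (forall a, 0 < `|a| < eps -> 0 < a * g a) -> 0 < beta -> rho < eps ->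
  exists2 k : R, 0 < k & forall a, beta <= `|a| <= rho -> k <= a * g a.
Proof.
move=> g_cont g_odd g_pos beta_gt0 rho_lt.
have [beta_le_rho|rho_lt_beta] := leP beta rho; last first.
  exists 1 => // a /andP[beta_le /(le_trans beta_le)].
  by rewrite leNgt rho_lt_beta.
have ag_cont : {within `[beta, rho], continuous (fun a => a * g a)}.
  apply: continuous_subspaceT => a.
  by apply: continuousM; [exact: cvg_id | exact: g_cont].
have [a0] := EVT_min beta_le_rho ag_cont.
rewrite in_itv /= => /andP[beta_le_a0 a0_le] a0_min.
have a0_gt0 : 0 < a0 := lt_le_trans beta_gt0 beta_le_a0.
exists (a0 * g a0) => [|a /andP[beta_le a_le]].
  by apply: g_pos; rewrite gtr0_norm // a0_gt0 (le_lt_trans a0_le).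
have [a_ge0|a_lt0] := leP 0 a.
  by apply: a0_min; rewrite in_itv /= -(ger0_norm a_ge0) beta_le.
rewrite -[a * g a]mulrNN -g_odd; apply: a0_min.
by rewrite in_itv /= -(ltr0_norm a_lt0) beta_le.
Qed.

Lemma uniform_pos_lower_bound (I : finType) (A : I -> R -> Prop) (h : I -> R -> R) :
  (forall i, exists2 k : R, 0 < k & forall a, A i a -> k <= h i a) ->
  exists2 k : R, 0 < k & forall i a, A i a -> k <= h i a.
Proof.
move=> bounds.
have /choice[k k_spec] : forall i, exists k : R, 0 < k /\ forall a, A i a -> k <= h i a.
  by move=> i; have [k k_gt0 k_le] := bounds i; exists k.
exists (\big[Order.min/1]_i k i) => [|i a Aia].
  by apply: lt_bigmin => // i _; case: (k_spec i).
by apply: le_trans (bigmin_le _ i _) _; case: (k_spec i) => _; apply.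
Qed.

End PositiveLowerBounds.

Section SquaredDistanceToDelta.
Context {R : realType} {n : nat}.
Implicit Types (y : 'I_n -> R) (k l : R).

Definition mean y : R := (\sum_i y i) / n%:R.

Definition sqdist_Delta y : R := \sum_i (y i - mean y) ^+ 2.

Lemma sum_sub_mean y : \sum_i (y i - mean y) = 0.
Proof.
rewrite sumrB sumr_const card_ord /mean.
case: n y => [|m] y; first by rewrite big_ord0 mulr0n subr0.
by rewrite -[(_ / _) *+ _]mulr_natr divfK ?subrr // pnatr_eq0.
Qed.

Lemma sum_sqr_sub y k :
  \sum_i (y i - k) ^+ 2 = sqdist_Delta y + n%:R * (mean y - k) ^+ 2.
Proof.
transitivity (\sum_i ((y i - mean y) ^+ 2
    + 2 * (mean y - k) * (y i - mean y) + (mean y - k) ^+ 2)).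
  by apply: eq_bigr => i _; ring.
rewrite !big_split /= -mulr_sumr sum_sub_mean mulr0 addr0 sumr_const card_ord.
by rewrite mulr_natl.
Qed.

Lemma sqdist_Delta_ge0 y : 0 <= sqdist_Delta y.
Proof. by apply: sumr_ge0 => i _; rewrite sqr_ge0. Qed.

Lemma sqdist_Delta_le_sum_sqr_sub y k : sqdist_Delta y <= \sum_i (y i - k) ^+ 2.
Proof. by rewrite sum_sqr_sub lerDl mulr_ge0 ?ler0n ?sqr_ge0. Qed.

Lemma dist_DeltaE y : dist_Delta y = Num.sqrt (sqdist_Delta y).
Proof.
have lower : lbound [set Defs.edist y z | z in @Delta R n] (Num.sqrt (sqdist_Delta y)).
  move=> _ [z Dz <-]; rewrite /Defs.edist ler_sqrt; last first.
    by apply: sumr_ge0 => i _; rewrite sqr_ge0.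
  case: (pickP 'I_n) => [i0 _|no_index]; last first.
    by rewrite /sqdist_Delta big1 ?sumr_ge0 // => i; have := no_index i.
  under eq_bigr do rewrite (Dz _ i0).
  exact: sqdist_Delta_le_sum_sqr_sub.
have attained : [set Defs.edist y z | z in @Delta R n] (Num.sqrt (sqdist_Delta y)).
  by exists (fun=> mean y).
by apply/eqP; rewrite eq_le ge_inf ?lb_le_inf //=; exists (Num.sqrt (sqdist_Delta y)).
Qed.

Lemma dist_Delta_ge0 y : 0 <= dist_Delta y.
Proof. by rewrite dist_DeltaE sqrtr_ge0. Qed.

Lemma sqdist_DeltaE y :
  sqdist_Delta y = \sum_i y i ^+ 2 - (\sum_i y i) ^+ 2 / n%:R.
Proof.
have := sum_sqr_sub y 0; under eq_bigr do rewrite subr0.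
move=> ->; rewrite subr0 /mean.
have [n0|n_neq0] := eqVneq (n%:R : R) 0; last by field.
by rewrite n0 !mul0r invr0 mulr0 !subr0 addr0.
Qed.

Lemma dist_DeltaZ l y : dist_Delta (fun i => l * y i) = `|l| * dist_Delta y.
Proof.
have mean_scale : mean (fun i => l * y i) = l * mean y by rewrite /mean -mulr_sumr mulrA.
rewrite !dist_DeltaE -sqrtr_sqr -sqrtrM ?sqr_ge0 // /sqdist_Delta mean_scale mulr_sumr.
by congr Num.sqrt; apply: eq_bigr => i _; ring.
Qed.

Lemma norm_sub_mean_le y i : `|y i - mean y| <= dist_Delta y.
Proof.
rewrite dist_DeltaE -sqrtr_sqr ler_sqrt ?sqdist_Delta_ge0 // /sqdist_Delta.
by rewrite (bigD1 i) //= lerDl sumr_ge0 // => j _; rewrite sqr_ge0.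
Qed.

Lemma norm_sub_le_dist_Delta y i j : `|y i - y j| <= 2 * dist_Delta y.
Proof.
rewrite -[y i - y j](subrKA (mean y)) (le_trans (ler_normD _ _)) //.
by rewrite mulr2n mulrDl mul1r lerD // ?norm_sub_mean_le // distrC norm_sub_mean_le.
Qed.

Lemma dist_Delta_lt_sqr y r : 0 < r -> (dist_Delta y < r) = (sqdist_Delta y < r ^+ 2).
Proof.
move=> r_gt0; rewrite dist_DeltaE -{1}(gtr0_norm r_gt0) -sqrtr_sqr.
by rewrite ltr_sqrt // exprn_gt0.
Qed.

End SquaredDistanceToDelta.

Section SqdistAlongCurves.
Context {R : realType} {n : nat}.

Lemma continuous_sqdist_Delta (X : topologicalType) (u : X -> 'I_n -> R) t :
  (forall i, {for t, continuous (u ^~ i)}) -> {for t, continuous (sqdist_Delta \o u)}.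
Proof.
move=> u_cont.
have sum_cont (F : 'I_n -> X -> R) : (forall i, {for t, continuous (F i)}) ->
    {for t, continuous (fun s => \sum_i F i s)}.
  by move=> F_cont; apply: (cvg_big (@add_continuous R)) => // i _; exact: F_cont.
apply: (sum_cont) => i; rewrite /mean.
under [X in {for t, continuous X}]eq_fun do rewrite expr2.
have dev_cont : {for t, continuous (fun s => u s i - (\sum_j u s j) / n%:R)}.
  by apply: continuousB => //; apply: continuousM; [exact: sum_cont | exact: cvg_cst].
exact: (continuousM dev_cont dev_cont).
Qed.

Lemma is_derive_sqdist_Delta (u : R -> 'I_n -> R) (t : R) (v : 'I_n -> R) :
  (forall i, is_derive t 1 (u ^~ i) (v i)) -> \sum_i v i = 0 ->
  is_derive t 1 (sqdist_Delta \o u) (2 * \sum_i u t i * v i).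
Proof.
move=> u_der v_sum0.
have -> : sqdist_Delta \o u =
    \sum_i (u ^~ i) ^+ 2 - n%:R^-1 \*: (\sum_i u ^~ i) ^+ 2.
  apply/funext => s; rewrite /= sqdist_DeltaE !fctE !fct_sumE /= mulrC.
  by under [in RHS]eq_bigr do rewrite fctE.
apply: is_derive_eq.
rewrite fct_sumE v_sum0 scaler0 scaler0 subr0 mulr_sumr.
by apply: eq_bigr => i _; rewrite /GRing.scale /=; ring.
Qed.

End SqdistAlongCurves.

Section AdmissibleRadius.
Context {R : realType} {n : nat} (E : rel 'I_n) (eps : R).
Hypothesis eps_gt0 : 0 < eps.

Lemma admissible_radius_half : admissible_radius E eps (eps / 2).
Proof.
move=> y y_near d c _; apply: le_lt_trans (norm_sub_le_dist_Delta y d c) _; lra.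
Qed.

(* Rescaling by l = 2r/(r+s) > 1 keeps the closed cylinder of radius s inside
   the admissible open one, so edge differences stay bounded away from eps. *)
Lemma admissible_radius_uniform (r s : R) : admissible_radius E eps r -> 0 <= s < r ->
  exists2 rho, rho < eps & forall y : 'I_n -> R, dist_Delta y <= s ->
    forall d c, E d c -> `|y d - y c| <= rho.
Proof.
move=> adm /andP[s_ge0 s_lt_r].
pose l := 2 * r / (r + s).
have l_gt1 : 1 < l by rewrite /l ltr_pdivlMr ?mul1r; lra.
have ls_lt_r : l * s < r.
  by rewrite /l mulrAC ltr_pdivrMr; nra.
have l_gt0 : 0 < l by lra.
exists (eps / l); first by rewrite ltr_pdivrMr // ltr_pMr.
move=> y y_near d c Edc.
have ly_near : dist_Delta (fun i => l * y i) < r.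
  rewrite dist_DeltaZ gtr0_norm //; apply: le_lt_trans ls_lt_r.
  by rewrite ler_wpM2l // ltW.
have := adm _ ly_near d c Edc.
rewrite -mulrBr normrM gtr0_norm // => ly_lt.
by rewrite ler_pdivlMr // mulrC ltW.
Qed.

End AdmissibleRadius.

Lemma norm_sub_last_path_le {R : realType} {n : nat} (e : rel 'I_n)
    (y : 'I_n -> R) (b : R) :
  (forall d c, e d c -> `|y d - y c| <= b) ->
  forall p i, path e i p -> `|y i - y (last i p)| <= (size p)%:R * b.
Proof.
move=> e_le; elim=> [|j p IHp] i /=; first by rewrite subrr normr0 mul0r.
case/andP=> e_ij path_p; rewrite -(subrKA (y j)) (le_trans (ler_normD _ _)) //.
by rewrite -addn1 natrD mulrDl mul1r addrC lerD ?IHp ?e_le.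
Qed.

Section Connectivity.
Context {R : realType} {n : nat} (E : rel 'I_n).
Hypothesis E_connected : connected_net E.

Lemma connected_norm_sub_le (y : 'I_n -> R) (b : R) : 0 <= b ->
  (forall d c, E d c -> `|y d - y c| <= b) -> forall i j, `|y i - y j| <= n%:R * b.
Proof.
move=> b_ge0 E_le i j.
have /connectP[p path_p ->] := E_connected i j.
have [q path_q uniq_q _] := shortenP path_p.
have sym_le d c : E d c || E c d -> `|y d - y c| <= b.
  by case/orP=> /E_le //; rewrite distrC.
apply: le_trans (norm_sub_last_path_le sym_le path_q) _.
rewrite ler_wpM2r // ler_nat.
have := max_card (mem (i :: q)); rewrite card_ord (card_uniqP uniq_q) /=.
exact: ltnW.
Qed.

Lemma connected_sqdist_Delta_le (y : 'I_n -> R) (b : R) : 0 <= b ->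
  (forall d c, E d c -> `|y d - y c| <= b) -> sqdist_Delta y <= n%:R * (n%:R * b) ^+ 2.
Proof.
move=> b_ge0 E_le.
case: (pickP 'I_n) => [i0 _|no_index]; last first.
  by rewrite /sqdist_Delta big1 ?mulr_ge0 ?sqr_ge0 // => i; have := no_index i.
apply: le_trans (sqdist_Delta_le_sum_sqr_sub y (y i0)) _.
have -> : n%:R * (n%:R * b) ^+ 2 = \sum_(i < n) (n%:R * b) ^+ 2.
  by rewrite sumr_const card_ord mulr_natl.
apply: ler_sum => i _.
rewrite -real_normK ?num_real // !expr2 ler_pM ?normr_ge0 //.
all: exact: connected_norm_sub_le.
Qed.

Lemma exists_large_edge (e : R) : 0 < e ->
  exists2 beta : R, 0 < beta & forall y : 'I_n -> R, e ^+ 2 <= sqdist_Delta y ->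
    exists d c, E d c /\ beta <= `|y d - y c|.
Proof.
move=> e_gt0; set N : R := n%:R; have N_ge0 : 0 <= N by rewrite ler0n.
have D_gt0 : 0 < N ^+ 2 + 1 by rewrite ltr_pwDr ?sqr_ge0.
exists (e / (N ^+ 2 + 1)) => [|y y_far]; first by rewrite divr_gt0.
apply: contrapT => no_large.
have small_edges d c : E d c -> `|y d - y c| <= e / (N ^+ 2 + 1).
  move=> Edc; rewrite leNgt; apply/negP => large; apply: no_large.
  by exists d, c; split; last exact: ltW.
have := connected_sqdist_Delta_le (ltW (divr_gt0 e_gt0 D_gt0)) small_edges.
move/(le_trans y_far).
apply/negP; rewrite -/N -ltNge.
have -> : N * (N * (e / (N ^+ 2 + 1))) ^+ 2 = N ^+ 3 / (N ^+ 2 + 1) ^+ 2 * e ^+ 2.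
  by field; rewrite gt_eqF.
by rewrite gtr_pMl ?exprn_gt0 // ltr_pdivrMr ?exprn_gt0 // mul1r; nra.
Qed.

End Connectivity.

Lemma sum_antisym_edges {R : realType} {n : nat} (E : rel 'I_n) (G : 'I_n -> 'I_n -> R) :
  (forall d c, E d c = E c d) -> (forall d c, E d c -> G d c = - G c d) ->
  \sum_c \sum_(d | E d c) G c d = 0.
Proof.
move=> E_sym G_anti; set S := \sum_c _.
suff : S = - S by lra.
rewrite {1}/S; under eq_bigr do rewrite big_mkcond.
rewrite exchange_big /= /S -sumrN; apply: eq_bigr => c _.
rewrite [in RHS]big_mkcond -sumrN; apply: eq_bigr => d _ /=.
by rewrite E_sym; case: ifP => [/G_anti|_]; rewrite ?oppr0.
Qed.

Section NetworkField.
Context {R : realType} {n : nat} {T : Type}.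
Variables (E : rel 'I_n) (etyp : 'I_n -> 'I_n -> T) (phi : T -> R -> R) (eps : R).
Hypothesis E_bidirected : bidirected E etyp.
Hypothesis phi_odd :
  forall d c, E d c -> forall a, phi (etyp d c) (- a) = - phi (etyp d c) a.

Let E_sym d c : E d c = E c d. Proof. by have [] := E_bidirected d c. Qed.

Let phi_anti d c a : E d c -> phi (etyp c d) (- a) = - phi (etyp d c) a.
Proof.
move=> Edc; have [_ /(_ Edc) ->] := E_bidirected d c.
by rewrite phi_odd // -E_sym.
Qed.

Lemma netfield_Delta (y : 'I_n -> R) : Delta y -> netfield E etyp phi y = (fun=> 0).
Proof.
move=> y_sync; apply/funext => c; apply: big1 => d Edc.
rewrite (y_sync d c) subrr.
have Ecd : E c d by rewrite -E_sym.
by have := phi_odd Ecd 0; rewrite oppr0; lra.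
Qed.

Lemma sum_netfield (y : 'I_n -> R) : \sum_c netfield E etyp phi y c = 0.
Proof.
apply: sum_antisym_edges E_sym _ => d c Edc.
by rewrite -[y c - y d]opprB phi_anti // -E_sym.
Qed.

Definition dissipation (y : 'I_n -> R) : R :=
  \sum_c \sum_(d | E d c) (y d - y c) * phi (etyp c d) (y d - y c).

Lemma netfield_dot (y : 'I_n -> R) :
  2 * \sum_c y c * netfield E etyp phi y c = - dissipation y.
Proof.
have sym_part : \sum_c \sum_(d | E d c) (y c + y d) * phi (etyp c d) (y d - y c) = 0.
  apply: sum_antisym_edges E_sym _ => d c Edc.
  have Ecd : E c d by rewrite -E_sym.
  by rewrite -[y c - y d]opprB phi_anti // mulrN addrC.
have pair_terms : 2 * \sum_c y c * netfield E etyp phi y c + dissipation y =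
    \sum_c \sum_(d | E d c) (y c + y d) * phi (etyp c d) (y d - y c).
  rewrite mulr_sumr /dissipation -big_split; apply: eq_bigr => c _ /=.
  rewrite /netfield !mulr_sumr -big_split; apply: eq_bigr => d _ /=; ring.
by apply/eqP; rewrite -subr_eq0 opprK pair_terms sym_part.
Qed.

Lemma is_derive_sqdist_Delta_netfield (x : R -> 'I_n -> R) (t : R) :
  (forall c, is_derive t 1 (x ^~ c) (netfield E etyp phi (x t) c)) ->
  is_derive t 1 (sqdist_Delta \o x) (- dissipation (x t)).
Proof.
move=> x_der; rewrite -netfield_dot.
exact: is_derive_sqdist_Delta x_der (sum_netfield _).
Qed.

Hypothesis phi_pos :
  forall d c, E d c -> forall a, 0 < `|a| < eps -> 0 < a * phi (etyp d c) a.

Lemma dissipation_term_ge0 (y : 'I_n -> R) d c : E d c -> `|y d - y c| < eps ->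
  0 <= (y d - y c) * phi (etyp c d) (y d - y c).
Proof.
move=> Edc y_dc_lt; have Ecd : E c d by rewrite -E_sym.
have [->|y_dc_neq0] := eqVneq (y d - y c) 0; first by rewrite mul0r.
by rewrite ltW // phi_pos // normr_gt0 y_dc_neq0.
Qed.

Lemma dissipation_ge0 (y : 'I_n -> R) :
  (forall d c, E d c -> `|y d - y c| < eps) -> 0 <= dissipation y.
Proof.
move=> y_edges; apply: sumr_ge0 => c _; apply: sumr_ge0 => d Edc.
exact: dissipation_term_ge0 (y_edges d c Edc).
Qed.

Lemma dissipation_ge_term (y : 'I_n -> R) : (forall d c, E d c -> `|y d - y c| < eps) ->
  forall d c, E d c -> (y d - y c) * phi (etyp c d) (y d - y c) <= dissipation y.
Proof.
move=> y_edges d0 c0 Ed0c0.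
have term_ge0 d c : E d c -> 0 <= (y d - y c) * phi (etyp c d) (y d - y c).
  by move=> Edc; exact: dissipation_term_ge0 (y_edges d c Edc).
rewrite /dissipation (bigD1 c0) //= (bigD1 d0) //= -addrA lerDl addr_ge0 //.
  by apply: sumr_ge0 => d /andP[Edc0 _]; exact: term_ge0.
by apply: sumr_ge0 => c _; apply: sumr_ge0 => d; exact: term_ge0.
Qed.

Hypothesis phi_cont : forall d c, E d c -> continuous (phi (etyp d c)).

Lemma dissipation_lower_bound (beta rho : R) : 0 < beta -> rho < eps ->
  exists2 k : R, 0 < k & forall y : 'I_n -> R,
    (forall d c, E d c -> `|y d - y c| <= rho) ->
    (exists d c, E d c /\ beta <= `|y d - y c|) -> k <= dissipation y.
Proof.
move=> beta_gt0 rho_lt.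
have /uniform_pos_lower_bound[k k_gt0 k_le] : forall dc : 'I_n * 'I_n,
    exists2 k : R, 0 < k & forall a, E dc.1 dc.2 /\ beta <= `|a| <= rho ->
      k <= a * phi (etyp dc.2 dc.1) a.
  move=> [d c] /=; have [Edc|_] := boolP (E d c); last by exists 1 => // a [].
  have Ecd : E c d by rewrite -E_sym.
  have [k k_gt0 k_le] := odd_pos_lower_bound (phi_cont Ecd) (phi_odd Ecd)
    (phi_pos Ecd) beta_gt0 rho_lt.
  by exists k => // a [_ /k_le].
exists k => // y y_below [d [c [Edc y_dc_ge]]].
have y_edges d' c' : E d' c' -> `|y d' - y c'| < eps.
  by move=> Ed'c'; exact: le_lt_trans (y_below d' c' Ed'c') rho_lt.
apply: le_trans (dissipation_ge_term y_edges Edc).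
by apply: (k_le (d, c)); rewrite /= y_dc_ge y_below.
Qed.

Hypothesis eps_gt0 : 0 < eps.
Hypothesis E_connected : connected_net E.

Section Solution.
Variable x : R -> 'I_n -> R.
Hypothesis x_sol : is_solution (netfield E etyp phi) x.

Lemma continuous_sqdist_Delta_solution :
  {within [set t : R | 0 <= t], continuous (sqdist_Delta \o x)}.
Proof.
case: x_sol => x_cont _ t.
exact: (@continuous_sqdist_Delta _ _ (subspace _) x t (fun i => x_cont i t)).
Qed.

Variable r : R.
Hypothesis r_adm : admissible_radius E eps r.
Hypothesis x0_near : dist_Delta (x 0) < r.

Lemma sqdist_Delta_solution_nonincreasing (s t : R) : 0 <= s -> s <= t ->
  sqdist_Delta (x t) <= sqdist_Delta (x s).
Proof.
have r_gt0 : 0 < r := le_lt_trans (dist_Delta_ge0 _) x0_near.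
apply: (nonincreasing_below_barrier (c := r ^+ 2)
  (dg := fun t => - dissipation (x t)) continuous_sqdist_Delta_solution).
- move=> u u_gt0; apply: is_derive_sqdist_Delta_netfield.
  by case: x_sol => _ x_der; exact: x_der.
- move=> u _; rewrite -dist_Delta_lt_sqr // oppr_le0 => xu_near.
  exact: dissipation_ge0 (r_adm xu_near).
- by rewrite -dist_Delta_lt_sqr.
Qed.

Lemma dist_Delta_solution_le (t : R) : 0 <= t -> dist_Delta (x t) <= dist_Delta (x 0).
Proof.
move=> t_ge0; rewrite !dist_DeltaE ler_sqrt ?sqdist_Delta_ge0 //.
exact: sqdist_Delta_solution_nonincreasing.
Qed.

(* While sqdist_Delta stays >= e^2 the dissipation is at least some k > 0, so
   sqdist_Delta would be negative at time (sqdist_Delta (x 0) + 1) / k. *)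
Lemma solution_approaches_Delta (e : R) : 0 < e ->
  exists2 t : R, 0 <= t & sqdist_Delta (x t) < e ^+ 2.
Proof.
move=> e_gt0; apply: contrapT => never_close.
have far t : 0 <= t -> e ^+ 2 <= sqdist_Delta (x t).
  by move=> t_ge0; rewrite leNgt; apply/negP => close; apply: never_close; exists t.
have [rho rho_lt near_edges] : exists2 rho, rho < eps &
    forall y, dist_Delta y <= dist_Delta (x 0) ->
      forall d c, E d c -> `|y d - y c| <= rho.
  by apply: (admissible_radius_uniform eps_gt0 r_adm); rewrite dist_Delta_ge0 x0_near.
have [beta beta_gt0 large_edge] := exists_large_edge E_connected e_gt0.
have [k k_gt0 k_le] := dissipation_lower_bound beta_gt0 rho_lt.
pose t1 := (sqdist_Delta (x 0) + 1) / k.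
have t1_ge0 : 0 <= t1 by rewrite divr_ge0 ?ltW // ltr_wpDl ?sqdist_Delta_ge0.
have : (sqdist_Delta \o x) t1 <= (sqdist_Delta \o x) 0 + (- k) * (t1 - 0).
  apply: (mean_value_le (df := fun t => - dissipation (x t)) t1_ge0).
  - move=> u /andP[u_gt0 _]; case: x_sol => _ x_der.
    exact: (is_derive_sqdist_Delta_netfield (x_der u u_gt0)).
  - move=> u /andP[u_gt0 _]; rewrite lerN2; apply: k_le.
      by apply: near_edges; exact: dist_Delta_solution_le (ltW u_gt0).
    by apply: large_edge; exact: far (ltW u_gt0).
  - exact: continuous_subspaceW (subset_itv_nonneg (lexx 0))
      continuous_sqdist_Delta_solution.
have -> : - k * (t1 - 0) = - (sqdist_Delta (x 0) + 1).
  by rewrite subr0 mulNr /t1 mulrCA divff ?gt_eqF ?mulr1.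
by have := sqdist_Delta_ge0 (x t1); rewrite /=; lra.
Qed.

End Solution.

Lemma Delta_stable (e : R) : 0 < e -> exists2 delta : R, 0 < delta &
  forall x, is_solution (netfield E etyp phi) x -> dist_Delta (x 0) < delta ->
    forall t : R, 0 <= t -> dist_Delta (x t) < e.
Proof.
move=> e_gt0; exists (Num.min e (eps / 2)) => [|x x_sol x0_near t t_ge0].
  by rewrite lt_min e_gt0 divr_gt0.
have x0_half : dist_Delta (x 0) < eps / 2.
  by apply: lt_le_trans x0_near _; rewrite ge_min lexx orbT.
apply: le_lt_trans (lt_le_trans x0_near _); last by rewrite ge_min lexx.
exact: (dist_Delta_solution_le x_sol (@admissible_radius_half _ _ E eps) x0_half t_ge0).
Qed.

Lemma Delta_attractive (x : R -> 'I_n -> R) :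
  is_solution (netfield E etyp phi) x -> Omega E eps (x 0) ->
  (fun t => dist_Delta (x t)) @ +oo --> (0 : R).
Proof.
move=> x_sol [r [r_adm x0_near]]; apply/cvgrPdist_lt => e e_gt0.
have [t0 t0_ge0 close] := solution_approaches_Delta x_sol r_adm x0_near e_gt0.
exists t0; split => [|t t0_lt_t]; first exact: num_real.
rewrite sub0r normrN ger0_norm ?dist_Delta_ge0 // dist_Delta_lt_sqr //.
apply: le_lt_trans close.
exact: (sqdist_Delta_solution_nonincreasing x_sol r_adm x0_near t0_ge0 (ltW t0_lt_t)).
Qed.

End NetworkField.

Theorem theorem5p1 (R : realType) (n : nat) (T U : Type)
  (E : rel 'I_n) (etyp : 'I_n -> 'I_n -> T) (ctyp : 'I_n -> U)
  (phi : T -> R -> R) (eps : R) :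
  no_loops E ->
  types_compatible E etyp ctyp ->
  connected_net E ->
  homogeneous E etyp ->
  bidirected E etyp ->
  (forall d c, E d c ->
     [/\ (forall a, phi (etyp d c) (- a) = - phi (etyp d c) a),
         (forall a, derivable (phi (etyp d c)) a 1) &
         continuous (derive1 (phi (etyp d c)))]) ->
  0 < eps ->
  (forall d c, E d c -> forall a, 0 < `|a| < eps -> 0 < a * phi (etyp d c) a) ->
  (forall x, Delta x -> netfield E etyp phi x = (fun _ => 0)) /\
  asymp_stable_Delta_on (netfield E etyp phi) (Omega E eps).
Proof.
move=> _ _ E_connected _ E_bidirected phi_reg eps_gt0 phi_pos.
have phi_odd d c : E d c -> forall a, phi (etyp d c) (- a) = - phi (etyp d c) a.
  by case/phi_reg.
have phi_cont d c : E d c -> continuous (phi (etyp d c)).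
  case/phi_reg => _ phi_der _ a.
  exact/differentiable_continuous/derivable1_diffP/phi_der.
split; first exact: netfield_Delta.
split; first exact: (Delta_stable E_bidirected phi_odd phi_pos eps_gt0).
exact: (Delta_attractive E_bidirected phi_odd phi_pos phi_cont eps_gt0 E_connected).
Qed.
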